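(* Let $p$ be a prime and $n$ a positive integer, and let $X=\mathbb{Z}_p[t,t^{-1}]/(t-n(1-t)^2)$, regarded as an Alexander quandle. Let $f:X^3\to X$ be $f(x,y,z)=(x-y)^{a_1}(y-z)^{a_2}$, where $a_i=p^{m_i}$ for non-negative integers $m_i$, $i=1,2$. Then the quandle $3$-cocycle invariant of the twist knot $k(2n)$ with $2n+2$ crossings is the multiset $$\Phi_f(k(2n))=\{\sqcup_{|X|^2}\,\big[-nt^{-a_1}+(1+n(1-t))^{a_1+a_2}\big]s^{a_1+a_2}\ |\ s\in X\}.$$
   Context: $\mathbb{Z}_p=\mathbb{Z}/p\mathbb{Z}$. A quandle is a set with a binary operation $*$ such that $a*a=a$; for all $a,b$ there is a unique $c$ with $a=c*b$; and $(a*b)*c=(a*c)*(b*c)$. Any $\mathbb{Z}[t,t^{-1}]$-module is a quandle (Alexander quandle) under $a*b=ta+(1-t)b$. A quandle $3$-cocycle with values in an abelian group $A$ is $\theta:X^3\to A$ with $\theta(x,x,y)=0=\theta(x,y,y)$ and $\theta\circ\partial_4=0$, where $\partial_4(x_1,\ldots,x_4)=\sum_{i=2}^4(-1)^i[(x_1,\ldots,x_{i-1},x_{i+1},\ldots,x_4)-(x_1*x_i,\ldots,x_{i-1}*x_i,x_{i+1},\ldots,x_4)]$ and $\theta$ is extended linearly. Here $A=X$ (additive group), and $f$ is a $3$-cocycle. The twist knot $k(2n)$: the oriented knot with the standard alternating diagram of $2n+2$ crossings made of two twist regions, a vertical column of $2n$ half twists on two strands (twisted about a vertical axis) and a clasp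 of $2$ crossings (two strands twisted about a horizontal axis), placed side by side: the two right-hand ends of the column are joined to the two left-hand ends of the clasp, and the two left-hand ends of the column are joined (around the outside) to the two right-hand ends of the clasp, upper end to upper end and lower to lower. The two strands are oriented antiparallel in each twist region; the $2n$ crossings of the column are positive and the $2$ clasp crossings are negative. (So $k(2)$ is the figure-eight knot and $k(4)$ is a chiral form of $6_1$; the Alexander polynomial is $t-n(1-t)^2$ up to units. The invariant does not depend on which of the two orientations of the knot is chosen, as twist knots are invertible.) Colorings: for an oriented diagram $K$ in the plane, each arc gets a normal such that (tangent, normal) is the positive orientation of the plane. A coloring by $X$ assigns an element of $X$ to each arc so that at every crossing with over-arc colored $z$, if $y$ is the color of the under-arc lying on the side from which the normal of the over-arc points (the source under-arc), then the other under-arc is colored $y*z$. A shadow coloring is a coloring together with an assignment of elements of $X$ to the regions of the complement of the diagram such that, whenever the normal of an arc colored $y$ points from a region colored $x$ to an adjacent region, the latter is colored $x*y$; an arc coloring together with the color of one region determines the shadow coloring. At a crossing $\tau$ let $x_\tau$ be the color of the source region (the region from which both the normals of the over- and under-arcs point), $y_\tau$ the color of the source under-arc, $z_\tau$ the color of the over-arc, and $\epsilon(\tau)=\pm1$ the usual sign of $\tau$. The quandle $3$-cocycle invariant $\Phi_\theta(K)$ is the multiset of the sums $\sum_\tau\epsilon(\tau)\,\theta(x_\tau,y_\tau,z_\tau)$ over all shadow colorings of $K$ by $X$. In a multiset, $\sqcup_k g$ denotes $k$ copies of $g$; so the displayed multiset contains, for each $s\in X$, $|X|^2$ copies of the indicated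 element. *)

(* Defs.v *)
From HB Require Import structures.
From mathcomp Require Import all_boot all_order all_algebra.
From mathcomp Require Import generic_quotient ring_quotient.
From mathcomp Require Import finmap multiset boolp ring.

Set Implicit Arguments.
Unset Strict Implicit.
Unset Printing Implicit Defensive.

Import GRing.Theory.
Local Open Scope ring_scope.

(* Quotient of a commutative ring by a principal ideal. The library's         *)
(* [ring_quotient] only covers proper ideals, whereas Z_p[t,t^-1] modulo      *)
(* t - n(1-t)^2 is the zero ring when p divides n.                            *)

Section PrincipalQuotient.
Variables (R : comPzRingType) (g : R).

Definition principal : {pred R} := [pred x | `[< exists c, x = c * g >]].

Fact principal_zmod_closed : zmod_closed principal.
Proof.
split=> [|x y /asboolP[a ->] /asboolP[b ->]]; apply/asboolP.
  by exists 0; rewrite mul0r.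
by exists (a - b); rewrite mulrBl.
Qed.

HB.instance Definition _ := GRing.isZmodClosed.Build R principal
  principal_zmod_closed.

Definition pquot : Type := Quotient.quot principal.

HB.instance Definition _ := Choice.on pquot.
HB.instance Definition _ := GRing.Zmodule.on pquot.

Definition pquot_pi (x : R) : pquot := (\pi_(Quotient.quot principal) x)%qT.
Definition pquot_mul (x y : pquot) : pquot := pquot_pi (repr x * repr y).

Lemma pquot_piP x y : reflect (exists c, x - y = c * g) (pquot_pi x == pquot_pi y).
Proof. by rewrite /pquot_pi -Quotient.idealrBE; apply: asboolP. Qed.

Lemma pquot_reprK (x : pquot) : pquot_pi (repr x) = x.
Proof. exact: reprK. Qed.

Fact pquot_pi_zmod : zmod_morphism pquot_pi.
Proof. by move=> x y; rewrite /pquot_pi raddfB. Qed.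

HB.instance Definition _ := GRing.isZmodMorphism.Build R pquot pquot_pi
  pquot_pi_zmod.

Lemma pquot_piM x y : pquot_pi (x * y) = pquot_mul (pquot_pi x) (pquot_pi y).
Proof.
have /pquot_piP[a ea] : pquot_pi x == pquot_pi (repr (pquot_pi x)).
  by rewrite pquot_reprK.
have /pquot_piP[b eb] : pquot_pi y == pquot_pi (repr (pquot_pi y)).
  by rewrite pquot_reprK.
apply/eqP/pquot_piP; exists (a * y + repr (pquot_pi x) * b).
by rewrite mulrDl -mulrA (mulrC y) mulrA -ea -mulrA -eb mulrBl mulrBr addrA subrK.
Qed.

Fact pquot_mulA : associative pquot_mul.
Proof.
move=> x y z; rewrite -(pquot_reprK x) -(pquot_reprK y) -(pquot_reprK z).
by rewrite -!pquot_piM mulrA.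
Qed.

Fact pquot_mulC : commutative pquot_mul.
Proof. by move=> x y; rewrite /pquot_mul mulrC. Qed.

Fact pquot_mul1 : left_id (pquot_pi 1) pquot_mul.
Proof. by move=> x; rewrite -(pquot_reprK x) -pquot_piM mul1r. Qed.

Fact pquot_mulDl : left_distributive pquot_mul +%R.
Proof.
move=> x y z; rewrite -(pquot_reprK x) -(pquot_reprK y) -(pquot_reprK z).
by rewrite -raddfD -!pquot_piM -raddfD mulrDl.
Qed.

HB.instance Definition _ := GRing.Zmodule_isComPzRing.Build pquot
  pquot_mulA pquot_mulC pquot_mul1 pquot_mulDl.

Fact pquot_pi_monoid : monoid_morphism pquot_pi.
Proof. by split=> // x y; rewrite pquot_piM. Qed.

HB.instance Definition _ := GRing.isMonoidMorphism.Build R pquot pquot_pi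
  pquot_pi_monoid.

Lemma pquot_pi_gen : pquot_pi g = 0.
Proof. by apply/eqP; rewrite -(raddf0 pquot_pi); apply/pquot_piP; exists 1; rewrite subr0 mul1r. Qed.

End PrincipalQuotient.

Section AffineSpan.
Variables (F : fieldType) (R : comPzRingType).
Variables (phi : {rmorphism {poly {poly F}} -> R}) (n : nat).
Let t : R := phi 'X%:P.
Let u : R := phi 'X.
Let k (a : F) : R := phi a%:P%:P.
Hypothesis tu : t * u = 1.
Hypothesis tE : t = n%:R * (1 - t) ^+ 2.

Lemma affine_span P : exists ab, phi P = k ab.1 + k ab.2 * t.
Proof.
have kD a b : k (a + b) = k a + k b by rewrite /k !rmorphD.
have kM a b : k (a * b) = k a * k b by rewrite /k !rmorphM.
have k1 : k 1 = 1 by rewrite /k !rmorph1.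
have k0 : k 0 = 0 by rewrite /k !rmorph0.
have kn m : k m%:R = m%:R by rewrite /k !rmorph_nat.
have [n0|n0] := eqVneq (n%:R : F) 0.
  have R1 : 1 = 0 :> R by rewrite -tu tE -kn n0 k0 !mul0r.
  by exists (0, 0); rewrite -[LHS]mul1r -[RHS]mul1r R1 !mul0r.
pose c := k n%:R^-1.
have nV : c * n%:R = 1 by rewrite /c -kn -kM mulVf.
pose S (y : R) := exists ab, y = k ab.1 + k ab.2 * t.
have SD y z : S y -> S z -> S (y + z).
  move=> [[a b] ->] [[a' b'] ->]; exists (a + a', b + b') => /=.
  by rewrite !kD; ring.
have SZ a y : S y -> S (k a * y).
  by move=> [[b b'] ->]; exists (a * b, a * b') => /=; rewrite !kM; ring.
have Sk a : S (k a) by exists (a, 0); rewrite /= k0; ring.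
have SN y : S y -> S (- y).
  move=> [[a b] ->]; exists (- a, - b) => /=.
  by rewrite /k !rmorphN -!/(k _); ring.
have Sn m y : S y -> S (m%:R * y) by rewrite -kn; apply/SZ.
have St : S t by exists (0, 1); rewrite /= k0 k1; ring.
have t2 : t * t = c * ((2 * n + 1)%:R * t - n%:R).
  have -> : (2 * n + 1)%:R * t - n%:R = n%:R * (t * t) + (t - n%:R * (1 - t) ^+ 2).
    by rewrite natrD natrM; ring.
  by rewrite -tE subrr addr0 mulrA nV mul1r.
have uE : u = c * ((2 * n + 1)%:R - n%:R * t).
  have e2 : t * ((2 * n + 1)%:R - n%:R * t) = n%:R.
    have -> : t * ((2 * n + 1)%:R - n%:R * t) = n%:R + (t - n%:R * (1 - t) ^+ 2).
      by rewrite natrD natrM; ring.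
    by rewrite -tE subrr addr0.
  transitivity (c * n%:R * u); first by rewrite nV mul1r.
  by rewrite -[in LHS]e2 -!mulrA; congr (c * _); rewrite mulrC -mulrA (mulrC u) tu mulr1.
have SMt y : S y -> S (y * t).
  move=> [[a b] ->] /=; rewrite mulrDl -mulrA t2.
  apply/SD; first exact: SZ.
  by apply/SZ/SZ/SD; [exact: Sn | rewrite -kn; apply/SN].
have SMu y : S y -> S (y * u).
  move=> Sy; rewrite uE mulrCA; apply/SZ; rewrite mulrBr; apply/SD.
    by rewrite mulrC; apply/Sn.
  by apply/SN; rewrite mulrCA; apply/Sn/SMt.
have SP (q : {poly F}) : S (phi q%:P).
  elim/poly_ind: q => [|q a IHq]; first by rewrite !rmorph0 -k0.
  by rewrite rmorphD rmorphM rmorphD rmorphM; apply/SD; [apply/SMt | apply/Sk].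
suff [ab ->] : S (phi P) by exists ab.
elim/poly_ind: P => [|P q IHP]; first by rewrite rmorph0 -k0.
by rewrite rmorphD rmorphM; apply/SD; [apply/SMu | apply/SP].
Qed.

End AffineSpan.

(* R[t, t^-1], presented as R[t][u] / (t u - 1).                              *)
Definition laurent (R : comNzRingType) : comPzRingType :=
  pquot ('X%:P * 'X - 1 : {poly {poly R}}).
Definition laurent_t (R : comNzRingType) : laurent R := pquot_pi _ 'X%:P.
Definition laurent_tV (R : comNzRingType) : laurent R := pquot_pi _ 'X.

(* Z_p[t, t^-1] / (t - n (1 - t)^2); 'F_p is Z/pZ for p prime.                *)
Definition twist_ring (p n : nat) : Type :=
  pquot (laurent_t 'F_p - n%:R * (1 - laurent_t 'F_p) ^+ 2).

HB.instance Definition _ p n := GRing.ComPzRing.on (twist_ring p n).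

Section TwistRing.
Variables p n : nat.
Local Notation X := (twist_ring p n).

Definition twist_t : X := pquot_pi _ (laurent_t 'F_p).
Definition twist_tV : X := pquot_pi _ (laurent_tV 'F_p).

Lemma twist_tK : twist_t * twist_tV = 1.
Proof.
rewrite /twist_t /twist_tV -rmorphM -[RHS](rmorph1 (pquot_pi _)).
congr (pquot_pi _ _); rewrite /laurent_t /laurent_tV -rmorphM.
by rewrite -[RHS](rmorph1 (pquot_pi _)); apply/eqP/pquot_piP; exists 1; rewrite mul1r.
Qed.

Lemma twist_tE : twist_t = n%:R * (1 - twist_t) ^+ 2.
Proof.
apply/eqP; rewrite -subr_eq0 -[X in _ == X](pquot_pi_gen _); apply/eqP.
by rewrite rmorphB rmorphM rmorphXn rmorphB rmorph1 rmorph_nat.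
Qed.

Definition twist_affine (ab : 'F_p * 'F_p) : X :=
  pquot_pi _ (pquot_pi _ ab.1%:P%:P : laurent 'F_p) +
  pquot_pi _ (pquot_pi _ ab.2%:P%:P : laurent 'F_p) * twist_t.

Lemma twist_affine_surj (x : X) : exists ab, twist_affine ab == x.
Proof.
pose phi : {rmorphism {poly {poly 'F_p}} -> X} :=
  pquot_pi (laurent_t 'F_p - n%:R * (1 - laurent_t 'F_p) ^+ 2)
  \o pquot_pi ('X%:P * 'X - 1).
have [ab ab_x] := @affine_span _ _ phi n twist_tK twist_tE (repr (repr x)).
by exists ab; rewrite -(pquot_reprK x) -(pquot_reprK (repr x)); apply/eqP/esym.
Qed.

Definition twist_coords (x : X) : 'F_p * 'F_p := xchoose (twist_affine_surj x).

Lemma twist_coordsK : cancel twist_coords twist_affine.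
Proof. by move=> x; apply/eqP/(xchooseP (twist_affine_surj x)). Qed.

HB.instance Definition _ := CanIsCountable twist_coordsK.
HB.instance Definition _ := isFinite.Build X (pcan_enumP (can_pcan twist_coordsK)).

End TwistRing.

Record finQuandle := FinQuandle {
  qcarrier :> finType;
  qop : qcarrier -> qcarrier -> qcarrier;
  qop_idem : forall a, qop a a = a;
  qop_div : forall a b, exists! c, a = qop c b;
  qop_dist : forall a b c, qop (qop a b) c = qop (qop a c) (qop b c)
}.
Arguments qop {f} a b.

Declare Scope quandle_scope.
Delimit Scope quandle_scope with Q.
Notation "a ▷ b" := (qop a b) (at level 50, left associativity) : quandle_scope.
Local Open Scope quandle_scope.

Section Alexander.
Variables (R : finComPzRingType) (t tV : R) (tK : t * tV = 1).

Definition alexander_op (a b : R) : R := t * a + (1 - t) * b.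

Fact alexander_idem a : alexander_op a a = a.
Proof. by rewrite /alexander_op; ring. Qed.

Fact alexander_div a b : exists! c, a = alexander_op c b.
Proof.
exists (tV * (a - (1 - t) * b)); split=> [|c ->]; rewrite /alexander_op.
  by rewrite mulrA tK; ring.
by rewrite addrK mulrA (mulrC tV) tK mul1r.
Qed.

Fact alexander_dist a b c :
  alexander_op (alexander_op a b) c =
  alexander_op (alexander_op a c) (alexander_op b c).
Proof. by rewrite /alexander_op; ring. Qed.

Lemma alexander_cocycle_identity (q1 q2 : nat) (x1 x2 x3 x4 : R)
    (op := alexander_op) :
  (forall x y : R, (x + y) ^+ q1 = x ^+ q1 + y ^+ q1) ->
  (forall x y : R, (x + y) ^+ q2 = x ^+ q2 + y ^+ q2) ->
  let f (x y z : R) := (x - y) ^+ q1 * (y - z) ^+ q2 in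
    (f x1 x3 x4 - f (op x1 x2) x3 x4)
  - (f x1 x2 x4 - f (op x1 x3) (op x2 x3) x4)
  + (f x1 x2 x3 - f (op x1 x4) (op x2 x4) (op x3 x4)) = 0.
Proof.
move=> D1 D2 f; rewrite /f /op /alexander_op.
set u := x1 - x2; set v := x2 - x3; set w := x3 - x4.
have -> : x1 - x3 = u + v by rewrite /u /v; ring.
have -> : t * x1 + (1 - t) * x2 - x3 = t * u + v by rewrite /u /v; ring.
have -> : t * x1 + (1 - t) * x3 - (t * x2 + (1 - t) * x3) = t * u.
  by rewrite /u; ring.
have -> : t * x2 + (1 - t) * x3 - x4 = t * v + w by rewrite /v /w; ring.
have -> : t * x1 + (1 - t) * x4 - (t * x2 + (1 - t) * x4) = t * u.
  by rewrite /u; ring.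
have -> : t * x2 + (1 - t) * x4 - (t * x3 + (1 - t) * x4) = t * v.
  by rewrite /v; ring.
have -> : x2 - x4 = v + w by rewrite /v /w; ring.
rewrite !(D1, D2) !exprMn.
move: (u ^+ q1) (v ^+ q1) (v ^+ q2) (w ^+ q2) (t ^+ q1) (t ^+ q2) => *.
by ring.
Qed.

Definition alexander_quandle : finQuandle :=
  FinQuandle alexander_idem alexander_div alexander_dist.

End Alexander.

Definition is_cocycle3 (X : finQuandle) (A : zmodType) (theta : X -> X -> X -> A) :=
  [/\ forall x y, theta x x y = 0,
      forall x y, theta x y y = 0
    & forall x1 x2 x3 x4,
        (theta x1 x3 x4 - theta (x1 ▷ x2) x3 x4)
      - (theta x1 x2 x4 - theta (x1 ▷ x3) (x2 ▷ x3) x4)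
      + (theta x1 x2 x3 - theta (x1 ▷ x4) (x2 ▷ x4) (x3 ▷ x4)) = 0].

Record cocycle3 (X : finQuandle) (A : zmodType) := Cocycle3 {
  cocycle3_fun :> X -> X -> X -> A;
  cocycle3P : is_cocycle3 cocycle3_fun
}.

(* Oriented link diagrams, encoded by their crossings and the way the four    *)
(* ends of the crossings are glued along the semi-arcs.                       *)
(* The ends at a crossing are numbered counterclockwise by 'Z_4; [over_out v] *)
(* is the end through which the over-arc leaves v (so that it enters through  *)
(* [over_out v + 2]). Positivity of v means that a counterclockwise quarter   *)
(* turn takes the direction of the over-arc to that of the under-arc.         *)

Definition under_leaves (o : 'Z_4) (positive : bool) : 'Z_4 :=
  if positive then o + 1 else o - 1.

Record diagram := Diagram {
  crossing : finType;
  over_out : crossing -> 'Z_4;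
  positive : crossing -> bool;
  glue : crossing * 'Z_4 -> crossing * 'Z_4;
  leaves (e : crossing * 'Z_4) : bool :=
    (e.2 == over_out e.1) || (e.2 == under_leaves (over_out e.1) (positive e.1));
  glueK : involutive glue;
  leaves_glue : forall e, leaves (glue e) = ~~ leaves e
}.

Definition crossing_end (D : diagram) : finType := (crossing D * 'Z_4)%type.

(* The pair (v, c) also stands for the sector at v between the ends c and     *)
(* c + 1, which lies to the left of the semi-arc at (v, c) seen from v. The   *)
(* same side is on the right when seen from the other extremity (v', c') of   *)
(* this semi-arc, so it is the sector (v', c' - 1) at v'. The regions of a    *)
(* connected diagram are the orbits of sectors under this map.                *)
Definition next_sector (D : diagram) (e : crossing_end D) : crossing_end D :=
  ((glue e).1, (glue e).2 - 1).

Section Colorings.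
Variables (X : finQuandle) (D : diagram).

(* Colors of arcs are given on ends of crossings: they agree at both          *)
(* extremities of a semi-arc, and along an over-arc. As normals point to the  *)
(* left, the source under-arc is at the end [over_out v - 1].                 *)
Definition is_coloring (col : {ffun crossing_end D -> X}) : bool :=
  [forall e, col (glue e) == col e] &&
  [forall v, let o := over_out v in
    (col (v, o + 2) == col (v, o)) &&
    (col (v, o + 1) == col (v, o - 1) ▷ col (v, o))].

(* Each semi-arc leaves exactly one crossing v, through an end c; the sector  *)
(* (v, c) is then on its left and (v, c - 1) on its right.                    *)
Definition is_region_coloring (col reg : {ffun crossing_end D -> X}) : bool :=
  [forall e, reg (next_sector e) == reg e] &&
  [forall e, leaves e ==> (reg e == reg (e.1, e.2 - 1) ▷ col e)].

Definition shadow_colorings :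
    {set {ffun crossing_end D -> X} * {ffun crossing_end D -> X}} :=
  [set s | is_coloring s.1 && is_region_coloring s.1 s.2].

(* The sector on the right of both the over-arc and the under-arc.            *)
Definition source_sector (v : crossing D) : crossing_end D :=
  (v, if positive v then over_out v - 1 else over_out v - 2).

Definition crossing_sign (v : crossing D) : int := if positive v then 1 else -1.

Definition cocycle_weight (A : zmodType) (theta : cocycle3 X A)
    (s : {ffun crossing_end D -> X} * {ffun crossing_end D -> X}) : A :=
  \sum_(v : crossing D)
    theta (s.2 (source_sector v)) (s.1 (v, over_out v - 1))
          (s.1 (v, over_out v)) *~ crossing_sign v.

Definition cocycle_invariant (A : zmodType) (theta : cocycle3 X A) : {mset A}%mset :=
  seq_mset [seq cocycle_weight theta s | s <- enum shadow_colorings].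

End Colorings.

(* The twist knot k(2n). The crossings of the column are numbered from top to *)
(* bottom; [inr false] and [inr true] are the left and right crossings of the *)
(* clasp. The strands at each crossing are drawn along the two diagonals. One *)
(* strand of the column runs down from its upper left end, the other runs up. *)

Definition NE : 'Z_4 := 0.
Definition NW : 'Z_4 := 1.
Definition SW : 'Z_4 := 2.
Definition SE : 'Z_4 := 3.

Section TwistKnot.
Variables (n : nat) (n_gt0 : (0 < n)%N).

Definition twist_crossing : finType := ('I_n.*2 + bool)%type.

Fact twist_top_subproof : (0 < n.*2)%N. Proof. by rewrite double_gt0. Qed.
Definition twist_top : 'I_n.*2 := Ordinal twist_top_subproof.
Definition twist_bottom : 'I_n.*2 := rev_ord twist_top.

Definition twist_glue (e : twist_crossing * 'Z_4) : twist_crossing * 'Z_4 :=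
  let: (v, c) := e in
  match v with
  | inl i =>
      if c == NW then
        if i == twist_top then (inr true, NE) else (inl (ord_pred i), SW)
      else if c == NE then
        if i == twist_top then (inr false, NW) else (inl (ord_pred i), SE)
      else if c == SW then
        if i == twist_bottom then (inr true, SE) else (inl (ordS i), NW)
      else
        if i == twist_bottom then (inr false, SW) else (inl (ordS i), NE)
  | inr false =>
      if c == NW then (inl twist_top, NE)
      else if c == NE then (inr true, NW)
      else if c == SW then (inl twist_bottom, SE)
      else (inr true, SW)
  | inr true =>
      if c == NW then (inr false, NE)
      else if c == NE then (inl twist_top, NW)
      else if c == SW then (inr false, SE)
      else (inl twist_bottom, SW)
  end.

(* Every over-arc runs along the NW-SE diagonal.                              *)
Definition twist_over_out (v : twist_crossing) : 'Z_4 :=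
  match v with
  | inl i => if odd i then NW else SE
  | inr false => SE
  | inr true => NW
  end.

Definition twist_positive (v : twist_crossing) : bool :=
  if v is inl _ then true else false.

Let twist_leaves (e : twist_crossing * 'Z_4) :=
  (e.2 == twist_over_out e.1) ||
  (e.2 == under_leaves (twist_over_out e.1) (twist_positive e.1)).

Lemma Z4_cases (P : 'Z_4 -> Prop) : P NE -> P NW -> P SW -> P SE -> forall c, P c.
Proof.
move=> P0 P1 P2 P3 [[|[|[|[|m]]]] // lt_m].
- by rewrite (_ : Ordinal _ = NE) //; apply: val_inj.
- by rewrite (_ : Ordinal _ = NW) //; apply: val_inj.
- by rewrite (_ : Ordinal _ = SW) //; apply: val_inj.
- by rewrite (_ : Ordinal _ = SE) //; apply: val_inj.
Qed.

Lemma val_ord_pred (i : 'I_n.*2) : i != twist_top -> ord_pred i = i.-1 :> nat.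
Proof.
rewrite -val_eqE /= -lt0n => i_gt0.
by rewrite -(prednK i_gt0) addSn /= modnDr modn_small // (leq_ltn_trans (leq_pred i)).
Qed.

Lemma val_ordS (i : 'I_n.*2) : i != twist_bottom -> ordS i = i.+1 :> nat.
Proof.
move=> neq_i; rewrite /= modn_small // ltn_neqAle ltn_ord andbT.
by apply: contraNneq neq_i => ei; rewrite -val_eqE /= -[X in _ == (X - _)%N]ei subn1.
Qed.

Fact twist_glueK : involutive twist_glue.
Proof.
have bot_val : twist_bottom = n.*2.-1 :> nat by rewrite /= subn1.
have pred_bot i : i != twist_top -> (ord_pred i == twist_bottom) = false.
  move=> ti; apply/eqP => /(congr1 (@nat_of_ord _)).
  rewrite val_ord_pred // bot_val => eq_i.
  have i_gt0 : (0 < i)%N by rewrite lt0n.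
  by have := ltn_ord i; rewrite -(prednK i_gt0) eq_i prednK ?ltnn // double_gt0.
have S_top i : i != twist_bottom -> (ordS i == twist_top) = false.
  by move=> bi; apply/eqP => /(congr1 (@nat_of_ord _)); rewrite val_ordS.
case=> [[i|[]] c]; elim/Z4_cases: c => /=; rewrite ?eqxx //=.
- by case: eqVneq => [->|ti] //=; rewrite pred_bot // ord_predK.
- by case: eqVneq => [->|ti] //=; rewrite pred_bot // ord_predK.
- by case: eqVneq => [->|bi] //=; rewrite S_top // ordSK.
- by case: eqVneq => [->|bi] //=; rewrite S_top // ordSK.
Qed.

Fact twist_leaves_glue e : twist_leaves (twist_glue e) = ~~ twist_leaves e.
Proof.
have odd_bot : odd twist_bottom.
  by rewrite /= subn1 -[odd _]negbK -oddS prednK ?odd_double // double_gt0.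
have odd_pred i : i != twist_top -> odd (ord_pred i) = ~~ odd i.
  move=> ti; rewrite val_ord_pred //.
  by rewrite -[odd i.-1]negbK -oddS prednK // lt0n.
have odd_S i : i != twist_bottom -> odd (ordS i) = ~~ odd i.
  by move=> bi; rewrite val_ordS.
case: e => [[i|[]] c]; elim/Z4_cases: c; rewrite /twist_leaves /=;
  move: odd_bot => /= odd_bot; rewrite ?odd_bot //.
- by case: (eqVneq i twist_top) => [->|ti] /=; [by [] | have /= -> := odd_pred i ti; case: (odd i)].
- by case: (eqVneq i twist_top) => [->|ti] /=; [by [] | have /= -> := odd_pred i ti; case: (odd i)].
- by case: (eqVneq i twist_bottom) => [->|bi] /=; [rewrite odd_bot | have /= -> := odd_S i bi; case: (odd i)].
- by case: (eqVneq i twist_bottom) => [->|bi] /=; [rewrite odd_bot | have /= -> := odd_S i bi; case: (odd i)].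
Qed.

Definition twist_knot : diagram := Diagram twist_glueK twist_leaves_glue.

End TwistKnot.

Definition twist_quandle (p n : nat) : finQuandle :=
  alexander_quandle (twist_tK p n).

Section TwistCocycle.
Variables (p : nat) (p_pr : prime p) (n m1 m2 : nat).
Local Notation X := (twist_ring p n).

Definition twist_cocycle_fun (x y z : twist_quandle p n) : X :=
  ((x : X) - y) ^+ (p ^ m1) * ((y : X) - z) ^+ (p ^ m2).

Lemma twist_Frobenius m (x y : X) :
  (x + y) ^+ (p ^ m) = x ^+ (p ^ m) + y ^+ (p ^ m).
Proof.
rewrite -(pquot_reprK x) -(pquot_reprK y).
rewrite -(pquot_reprK (repr x)) -(pquot_reprK (repr y)).
rewrite -!rmorphD -!rmorphXn -!rmorphD; do 2!congr (pquot_pi _ _).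
apply: exprDn_pchar; rewrite pnatX pnatE //.
by rewrite (pchar_poly {poly 'F_p}) (pchar_poly 'F_p) pchar_Fp.
Qed.

Lemma twist_cocycle_subproof : is_cocycle3 twist_cocycle_fun.
Proof.
have q_gt0 m : (0 < p ^ m)%N by rewrite expn_gt0 prime_gt0.
split=> [x y|x y|x1 x2 x3 x4]; rewrite /twist_cocycle_fun.
- by rewrite subrr expr0n gtn_eqF // mul0r.
- by rewrite subrr expr0n gtn_eqF // mulr0.
by apply: alexander_cocycle_identity => x y; apply: twist_Frobenius.
Qed.

Definition twist_cocycle : cocycle3 (twist_quandle p n) X :=
  Cocycle3 twist_cocycle_subproof.

End TwistCocycle.

(* Main.v *)
Require Import Defs.
From HB Require Import structures.
From mathcomp Require Import all_boot all_order all_algebra.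
From mathcomp Require Import finmap multiset.
From mathcomp Require Import ring.

(** Every shadow coloring of the twist knot is computed explicitly. Reading the
    column downwards, the colors at the upper ends of its crossings form a
    sequence [strand a d] given by the color [a] of its upper left end and the
    difference [d] between its two upper ends. Along the column, [d] is
    multiplied alternately by [-t^-1] and [-t], so two crossings add
    [(t^-1 - 1) d] to both colors. The clasp closes the coloring up exactly
    because [t = n (1 - t)^2] in [X], so [a] and [d] are arbitrary, and so is
    the color [e] of the region on the right of the column. This gives a
    bijection [strand_shadow] between [X^3] and the shadow colorings
    ([shadow_colorings_strand]).

    The powers [a1] and [a2] are additive on [X], by Frobenius. Hence the
    weights of two successive crossings of the column telescope: the
    dependence on [e] cancels, and each pair contributes
    [- (t^-1 d)^a1 (t^-1 d)^a2]. The two clasp crossings combine in the same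
    way into [(t^-1 K d)^a1 (K d)^a2], where [K = 1 + n (1 - t)]
    ([twist_unit]) is the factor by which [d] shifts the colors across the
    whole column. So the weight is
    [(- n t^-(a1 + a2) + K^(a1 + a2) t^-a1) d^(a1 + a2)], and the relations
    satisfied by [K] turn this coefficient into the announced one
    ([twist_coefficient]). As the weight depends on [d] only, each value of [d]
    accounts for [|X|^2] shadow colorings, one for each choice of [a] and
    [e]. *)

Set Implicit Arguments.
Unset Strict Implicit.
Unset Printing Implicit Defensive.

Import GRing.Theory.
Local Open Scope ring_scope.

(** * Additive powers *)

Section AdditivePower.
Variable R : comPzRingType.

Definition additive_exp q := forall x y : R, (x + y) ^+ q = x ^+ q + y ^+ q.

Variables (q : nat) (D : additive_exp q).

Lemma additive_exp0 : (0 : R) ^+ q = 0.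
Proof. by apply: (addrI (0 ^+ q)); rewrite -D !addr0. Qed.

Lemma additive_expN (x : R) : (- x) ^+ q = - x ^+ q.
Proof. by apply/eqP; rewrite -addr_eq0 -D addNr additive_exp0. Qed.

Lemma additive_expB (x y : R) : (x - y) ^+ q = x ^+ q - y ^+ q.
Proof. by rewrite D additive_expN. Qed.

Lemma additive_exp_nat m : (m%:R : R) ^+ q = m%:R.
Proof.
elim: m => [|m IHm]; first exact: additive_exp0.
by rewrite -natr1 D IHm expr1n.
Qed.

End AdditivePower.

(** * The element [1 + n (1 - t)] *)

Section TwistUnit.
Variables (R : comPzRingType) (t tV : R) (n : nat).
Hypotheses (tK : t * tV = 1) (tE : t = n%:R * (1 - t) ^+ 2).

Definition twist_unit : R := 1 + n%:R * (1 - t).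
Local Notation K := twist_unit.

(** In this form [K] is met in the diagram: each of the [n] pairs of crossings
    of the column shifts the colors by [(t^-1 - 1) d]. *)
Lemma twist_unitE : K = n%:R * (tV - 1).
Proof.
have -> : n%:R * (tV - 1) = tV * (n%:R * (1 - t)).
  by rewrite [RHS]mulrCA [in RHS]mulrBr mulr1 [tV * t]mulrC tK.
have nE : n%:R * (1 - t) = t * (1 + n%:R * (1 - t)).
  transitivity (n%:R * (1 - t) ^+ 2 + t * (n%:R * (1 - t))); first by ring.
  by rewrite -tE [RHS]mulrDr mulr1.
by rewrite [in RHS]nE mulrA [tV * t]mulrC tK mul1r.
Qed.

Lemma t_twist_unit : t * K = K - 1.
Proof. by rewrite {2}/twist_unit twist_unitE mulrCA mulrBr tK mulr1; ring. Qed.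

Lemma tV_twist_unit : tV * K = K + tV.
Proof.
have e : t * (tV * K) = t * (K + tV).
  by rewrite mulrA tK mul1r mulrDr tK t_twist_unit subrK.
by rewrite -[LHS]mul1r -[RHS]mul1r -tK mulrAC -[RHS]mulrAC; rewrite e.
Qed.

Lemma natr_tV : n%:R * tV = K + n%:R.
Proof. by rewrite twist_unitE mulrBr mulr1 subrK. Qed.

(** Raising [n t^-1 = K + n] to the powers [q1] and [q2], and
    [t^-1 K = K + t^-1] to the power [q1], makes both sides equal to
    [K^q1 K^q2 - K^q1 - n]. *)
Lemma twist_coefficient q1 q2
    (D1 : additive_exp R q1) (D2 : additive_exp R q2) :
  - (n%:R * tV ^+ (q1 + q2)) + K ^+ (q1 + q2) * tV ^+ q1
  = - (n%:R * tV ^+ q1) + K ^+ (q1 + q2).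
Proof.
have exp_n q : additive_exp R q -> n%:R * tV ^+ q = K ^+ q + n%:R.
  move=> D; rewrite -{1}(additive_exp_nat D n) -exprMn natr_tV D.
  by rewrite additive_exp_nat.
have := congr1 (fun x : R => x ^+ q1) tV_twist_unit; rewrite exprMn D1.
move: (exp_n _ D1) (exp_n _ D2).
rewrite !exprD; set u := K ^+ q1; set v := K ^+ q2.
set T := tV ^+ q1; set S := tV ^+ q2 => nT nS Tu.
rewrite [_ * (T * S)]mulrCA nS mulrDr [T * n%:R]mulrC nT.
by move: Tu; move: n%:R => N Tu; ring: Tu.
Qed.

End TwistUnit.

(** * Uniqueness of region colorings *)

Section RegionColorings.
Variables (X : finQuandle) (D : diagram).
Local Open Scope quandle_scope.

Lemma qop_inj (z : X) : injective (qop^~ z).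
Proof.
move=> x y eq_xy; have [c [_ uniq_c]] := qop_div (x ▷ z) z.
by rewrite -(uniq_c x) // (uniq_c y).
Qed.

Variables col reg reg' : {ffun crossing_end D -> X}.
Hypotheses (reg_P : is_region_coloring col reg).
Hypotheses (reg'_P : is_region_coloring col reg').

Lemma region_coloring_leaves r (x : crossing_end D) :
  is_region_coloring col r -> leaves x -> r x = r (x.1, x.2 - 1) ▷ col x.
Proof.
move=> /andP[_ /forallP r_leaves] x_leaves.
exact/eqP/(implyP (r_leaves x)).
Qed.

Lemma region_coloring_next r (x : crossing_end D) :
  is_region_coloring col r -> r (next_sector x) = r x.
Proof. by move=> /andP[/forallP r_next _]; apply/eqP. Qed.

(** Each semi-arc lets one recover the color of either of its sides from that
    of the other, so agreement in one sector spreads all around the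
    crossing. *)
Lemma region_coloring_turn v c c' :
  reg (v, c) = reg' (v, c) -> reg (v, c') = reg' (v, c').
Proof.
have back b : reg (v, b) = reg' (v, b) -> reg (v, b - 1) = reg' (v, b - 1).
  case: (boolP (leaves ((v, b) : crossing_end D))) => [leaves_b|].
    rewrite (region_coloring_leaves reg_P leaves_b).
    by rewrite (region_coloring_leaves reg'_P leaves_b) => /qop_inj.
  (* The semi-arc enters v through b, so its rule is read at its other end. *)
  move: (leaves_glue (v, b)) => + enters_b; rewrite enters_b => leaves_g.
  have nextE r : is_region_coloring col r ->
      r (v, b - 1) = r (v, b) ▷ col (glue ((v, b) : crossing_end D)).
    move=> r_P; rewrite -(region_coloring_next (v, b) r_P).
    rewrite -(region_coloring_leaves r_P leaves_g).
    by rewrite -[RHS](region_coloring_next _ r_P) /next_sector glueK.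
  by move=> eq_b; rewrite (nextE _ reg_P) (nextE _ reg'_P) eq_b.
move=> eq_c.
have turn k : reg (v, c - k%:R) = reg' (v, c - k%:R).
  elim: k => [|k IHk]; first by rewrite subr0.
  by rewrite -natr1 opprD addrA; apply: back.
by have := turn (nat_of_ord (c - c')); rewrite natr_Zp opprB addrC subrK.
Qed.

Lemma region_coloring_glue v c c' : (forall b, reg (v, b) = reg' (v, b)) ->
  let v' := (glue ((v, c) : crossing_end D)).1 in reg (v', c') = reg' (v', c').
Proof.
move=> eq_v v'.
apply: (@region_coloring_turn _ ((glue ((v, c) : crossing_end D)).2 - 1)).
have := eq_v c; rewrite -(region_coloring_next _ reg_P).
by rewrite -(region_coloring_next _ reg'_P).
Qed.

End RegionColorings.

(** * Coloring rules of the twist knot *)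

Lemma rotate_ends :
  (NW + 1 = SW) * (SE + 1 = NE) * (NW + 2 = SE) * (SE + 2 = NW)
  * (NE - 1 = SE) * (NW - 1 = NE) * (SW - 1 = NW) * (SE - 1 = SW)
  * (NW - 2 = SE) * (SE - 2 = NW).
Proof. by do !split; apply: val_inj. Qed.

Definition ends T (ne nw sw se : T) (c : 'Z_4) : T :=
  if c == NE then ne else if c == NW then nw else if c == SW then sw else se.

Section TwistDiagram.
Variables (X : finQuandle) (n : nat) (n_gt0 : (0 < n)%N).
Local Notation D := (twist_knot n_gt0).
Local Notation top := (twist_top n_gt0).
Local Notation bottom := (twist_bottom n_gt0).
Local Open Scope quandle_scope.
Implicit Types col reg : {ffun crossing_end D -> X}.

Lemma twist_bottomS : (bottom : nat).+1 = n.*2.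
Proof. by rewrite /= subn1 prednK // double_gt0. Qed.

Lemma twist_connected (P : twist_crossing n -> Prop) :
  P (inl top) ->
  (forall x : twist_crossing n * 'Z_4, P x.1 -> P (twist_glue n_gt0 x).1) ->
  forall v, P v.
Proof.
move=> Ptop Pglue.
have Pcol j (lt_j : (j < n.*2)%N) : P (inl (Ordinal lt_j)).
  elim: j lt_j => [|j IHj] lt_j.
    by rewrite (_ : Ordinal lt_j = top) //; apply: ord_inj.
  have j_bot : Ordinal (ltnW lt_j) != bottom.
    rewrite -val_eqE -eqSS; move: twist_bottomS => /= ->.
    by rewrite ltn_eqF.
  have := Pglue (inl (Ordinal (ltnW lt_j)), SE) (IHj (ltnW lt_j)).
  rewrite /= (negbTE j_bot) (_ : ordS _ = Ordinal lt_j) //.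
  by apply: ord_inj; rewrite (val_ordS j_bot).
have Pleft : P (inr false) by apply: (Pglue (inl top, NE)).
case=> [[j lt_j]|[]] //; exact: (Pglue (inr false, NE)).
Qed.

Lemma twist_over_outP (v : twist_crossing n) :
  twist_over_out v = NW \/ twist_over_out v = SE.
Proof. by case: v => [i|[]] /=; [case: ifP|..]; by [left | right]. Qed.

(** The under-arc runs along the SW-NE diagonal, and its source end depends
    only on the direction of the over-arc. *)
Lemma twist_coloringP col : reflect
  [/\ forall x, col (twist_glue n_gt0 x) = col x,
      forall v, col (v, SE) = col (v, NW)
    & forall v, if twist_over_out v == NW
                then col (v, SW) = col (v, NE) ▷ col (v, NW)
                else col (v, NE) = col (v, SW) ▷ col (v, NW)]
  (is_coloring col).
Proof.
apply: (iffP andP) => [[/'forall_eqP glue_col /forallP over_col]|].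
  split=> // v; have /andP[] := over_col v; rewrite /=;
    case: (twist_over_outP v) => ->;
    by rewrite !rotate_ends => /eqP over /eqP; rewrite ?over.
move=> [glue_col over under]; split; first by apply/'forall_eqP.
apply/forallP=> v /=; have := under v; have := over v.
case: (twist_over_outP v) => -> /= eq_over eq_under;
  by rewrite !rotate_ends eq_over -eq_under !eqxx.
Qed.

Lemma twist_region_coloringI col reg :
  (forall x, reg (next_sector x) = reg x) ->
  (forall v, if twist_over_out v == NW
             then reg (v, NW) = reg (v, NE) ▷ col (v, NW)
             else reg (v, SE) = reg (v, SW) ▷ col (v, SE)) ->
  (forall v, if under_leaves (twist_over_out v) (twist_positive v) == SW
             then reg (v, SW) = reg (v, NW) ▷ col (v, SW)
             else reg (v, NE) = reg (v, SE) ▷ col (v, NE)) ->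
  is_region_coloring col reg.
Proof.
move=> sector_reg over under; apply/andP; split; first by apply/'forall_eqP.
apply/'forall_implyP => -[v c]; rewrite /leaves /=.
have := under v; have := over v.
case: (twist_over_outP v) => ->; case: (twist_positive v);
  rewrite /= !rotate_ends /= => eq_over eq_under /orP[] /eqP ->;
  by rewrite rotate_ends -?eq_over -?eq_under.
Qed.

End TwistDiagram.

(** * Shadow colorings of the twist knot *)

Section TwistColorings.
Variables (R : finComPzRingType) (t tV : R) (tK : t * tV = 1).
Variables (n : nat) (n_gt0 : (0 < n)%N) (tE : t = n%:R * (1 - t) ^+ 2).
Local Notation X := (alexander_quandle tK).
Local Notation D := (twist_knot n_gt0).
Local Notation top := (twist_top n_gt0).
Local Notation bottom := (twist_bottom n_gt0).
Local Notation K := (twist_unit t n).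
Implicit Types (col reg : {ffun crossing_end D -> X}) (a d e : R).

(** The colors met going down the column, numbered so that crossing [i] has
    [strand a d i] at NE, [strand a d i.+1] on its over-arc and
    [strand a d i.+2] at SW. *)
Definition strand a d j : R :=
  a + (tV - 1) * d *+ j./2 + (if odd j then 0 else d).

Lemma strand0 a d : strand a d 0 = a + d.
Proof. by rewrite /strand /= mulr0n addr0. Qed.

Lemma strand1 a d : strand a d 1 = a.
Proof. by rewrite /strand /= mulr0n !addr0. Qed.

Lemma strandS a d j :
  strand a d j.+1 = strand a d j + (if odd j then tV * d else - d).
Proof.
rewrite /strand /= uphalf_half; case: (odd j) => /=.
  by rewrite add1n mulrS; ring.
by rewrite add0n; ring.
Qed.

Lemma strand_odd a d j : odd j ->
  strand a d j.+2 = t * strand a d j + (1 - t) * strand a d j.+1.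
Proof. by move=> odd_j; rewrite !strandS /= odd_j /=; ring: tK. Qed.

Lemma strand_even a d j : ~~ odd j ->
  strand a d j = t * strand a d j.+2 + (1 - t) * strand a d j.+1.
Proof. by move=> /negbTE even_j; rewrite !strandS /= even_j /=; ring: tK. Qed.

Lemma strand_next a d j (x y z : X) :
  y = strand a d j -> z = strand a d j.+1 ->
  (if odd j then x = qop y z else y = qop x z) -> x = strand a d j.+2.
Proof.
move=> -> ->; have [odd_j|even_j] /= := boolP (odd j).
  by rewrite /alexander_op -strand_odd.
by rewrite (strand_even a d even_j) => /(@qop_inj X).
Qed.

Lemma strand_last a d : strand a d n.*2 = a + d + K * d.
Proof.
rewrite /strand odd_double doubleK (twist_unitE tK tE).
by rewrite -mulr_natl mulrA; ring.
Qed.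

Lemma strand_lastS a d : strand a d n.*2.+1 = a + K * d.
Proof.
rewrite /strand /= odd_double /= uphalf_double (twist_unitE tK tE).
by rewrite -mulr_natl mulrA; ring.
Qed.

Definition strand_coloring a d : {ffun crossing_end D -> X} :=
  [ffun x : twist_crossing n * 'Z_4 => let s := strand a d in
   match x.1 with
   | inl i => ends (s i) (s i.+1) (s i.+2) (s i.+1) x.2
   | inr false => ends (s n.*2.+1) (s 0%N) (s n.*2) (s 0%N) x.2
   | inr true => ends (s 1%N) (s n.*2.+1) (s 0%N) (s n.*2.+1) x.2
   end].

(** At the clasp, both coloring rules reduce to [t K = K - 1]. *)
Lemma strand_coloringP a d : is_coloring (strand_coloring a d).
Proof.
apply/twist_coloringP; split.
- case=> [[i|[]] c]; elim/Z4_cases: c; rewrite !ffunE //=.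
  + have [->|ti] := eqVneq i top; rewrite /ends //=.
    by move: (val_ord_pred ti) => /= ->; rewrite prednK // lt0n.
  + have [->|ti] := eqVneq i top; rewrite /ends //=.
    by move: (val_ord_pred ti) => /= ->; rewrite prednK // lt0n.
  + have [->|bi] := eqVneq i bottom; rewrite /ends //=.
      by rewrite (twist_bottomS n_gt0).
    by move: (val_ordS bi) => /= ->.
  + have [->|bi] := eqVneq i bottom; rewrite /ends //=.
      by rewrite (twist_bottomS n_gt0).
    by move: (val_ordS bi) => /= ->.
  + by rewrite /ends /= (twist_bottomS n_gt0).
  + by rewrite /ends /= (twist_bottomS n_gt0).
- by case=> [i|[]]; rewrite !ffunE.
case=> [i|[]]; rewrite !ffunE /ends /= /alexander_op.
- have [odd_i|even_i] /= := boolP (odd i); first exact: strand_odd.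
  exact: strand_even.
- by rewrite strand0 strand1 strand_lastS; ring: (t_twist_unit tK tE).
- by rewrite strand0 strand_last strand_lastS; ring: (t_twist_unit tK tE).
Qed.

(** The upper ends of the first crossing determine the colors all the way down
    the column, and then those of the clasp. *)
Lemma coloring_strandP col : is_coloring col ->
  exists a d, col = strand_coloring a d.
Proof.
move=> /twist_coloringP[glue_col over under].
pose a : R := col (inl top, NW); pose d : R := (col (inl top, NE) : R) - a.
have upperE j (lt_j : (j < n.*2)%N) :
    col (inl (Ordinal lt_j), NE) = strand a d j /\
    col (inl (Ordinal lt_j), NW) = strand a d j.+1.
  elim: j lt_j => [|j IHj] lt_j.
    have -> : Ordinal lt_j = top by apply: val_inj.
    by rewrite strand0 strand1 /d addrC subrK.
  have [ne nw] := IHj (ltnW lt_j).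
  have predE : ord_pred (Ordinal lt_j) = Ordinal (ltnW lt_j).
    by apply: ord_inj; rewrite (@val_ord_pred n n_gt0).
  have := glue_col (inl (Ordinal lt_j), NE).
  have := glue_col (inl (Ordinal lt_j), NW).
  rewrite /= predE => <- <-; rewrite over nw; split=> //.
  apply: strand_next ne nw _.
  by have := under (inl (Ordinal (ltnW lt_j))); rewrite /=; case: (odd j).
have colE (i : 'I_n.*2) : [/\ col (inl i, NE) = strand a d i,
    col (inl i, NW) = strand a d i.+1, col (inl i, SE) = strand a d i.+1
  & col (inl i, SW) = strand a d i.+2].
  have [ne nw] : col (inl i, NE) = strand a d i /\
      col (inl i, NW) = strand a d i.+1.
    by have := upperE i (ltn_ord i);
       rewrite (_ : Ordinal _ = i) //; apply: ord_inj.
  rewrite over; split=> //; apply: strand_next ne nw _.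
  by have := under (inl i); rewrite /=; case: (odd i).
exists a, d; apply/ffunP=> -[v c]; rewrite ffunE /=.
have [topNE topNW _ _] := colE top.
have [_ _ botSE botSW] := colE bottom; rewrite twist_bottomS in botSE botSW.
have LNW : col (inr false, NW) = strand a d 0 by rewrite -topNE -glue_col.
have LSW : col (inr false, SW) = strand a d n.*2 by rewrite -botSE -glue_col.
have LSE : col (inr false, SE) = strand a d 0 by rewrite over.
have RNE : col (inr true, NE) = strand a d 1 by rewrite -topNW -glue_col.
have RSE : col (inr true, SE) = strand a d n.*2.+1 by rewrite -botSW -glue_col.
have RNW : col (inr true, NW) = strand a d n.*2.+1 by rewrite -RSE over.
have RSW : col (inr true, SW) = strand a d 0 by rewrite -LSE -glue_col.
have LNE : col (inr false, NE) = strand a d n.*2.+1 by rewrite -RNW -glue_col.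
by case: v => [i|[]]; elim/Z4_cases: c => //; case: (colE i).
Qed.

(** The color of the region just above crossing [j] of the column, or below
    the column if [j] is its length; [e] is the color on the right of the
    column. The semi-arcs bounding the column on the right alternate in
    direction, whence the two cases. *)
Definition level a d e j : R :=
  let s := strand a d j in
  if odd j then tV * (e - (1 - t) * s) else t * e + (1 - t) * s.

(** The color of the region on the left of the column, which is also on the
    right of the clasp. *)
Definition west d e : R := e + (tV - 1) * d.

Definition strand_regions a d e : {ffun crossing_end D -> X} :=
  [ffun x : twist_crossing n * 'Z_4 => let r := level a d e in
   let clasp_center := t * r n.*2 + (1 - t) * strand a d 0 in
   match x.1 with
   | inl i => ends (r i) (west d e) (r i.+1) e x.2
   | inr false => ends (r 0%N) e (r n.*2) clasp_center x.2
   | inr true => ends (r 0%N) clasp_center (r n.*2) (west d e) x.2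
   end].

Lemma strand_regionsP a d e :
  is_region_coloring (strand_coloring a d) (strand_regions a d e).
Proof.
have even_level j : ~~ odd j -> level a d e j = t * e + (1 - t) * strand a d j.
  by rewrite /level => /negbTE ->.
have odd_level j : odd j -> e = t * level a d e j + (1 - t) * strand a d j.
  by rewrite /level => ->; ring: tK.
apply: twist_region_coloringI.
- case=> [[i|[]] c]; elim/Z4_cases: c;
    rewrite !ffunE /= ?rotate_ends /ends //=.
  + have [->|ti] := eqVneq i top; rewrite /= ?rotate_ends //=.
    by move: (val_ord_pred ti) => /= ->; rewrite prednK // lt0n.
  + by have [_|_] := eqVneq i top; rewrite /= ?rotate_ends.
  + have [->|bi] := eqVneq i bottom; rewrite /= ?rotate_ends //=.
      by move: (twist_bottomS n_gt0) => /= ->.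
    by move: (val_ordS bi) => /= ->.
  + by have [_|_] := eqVneq i bottom; rewrite /= ?rotate_ends.
  + by move: (twist_bottomS n_gt0) => /= ->.
- case=> [i|[]]; rewrite !ffunE /ends /= /alexander_op //.
    have [odd_i|even_i] /= := boolP (odd i); last exact: (odd_level i.+1).
    by rewrite strandS odd_i /west {1}(odd_level _ odd_i); ring: tK.
  rewrite !even_level ?odd_double // strand0 strand_last strand_lastS.
  by ring: (t_twist_unit tK tE).
- case=> [i|[]]; rewrite !ffunE /ends /= /alexander_op ?rotate_ends /=.
  + have [odd_i|even_i] /= := boolP (odd i); rewrite ?rotate_ends /=.
      rewrite even_level /= ?odd_i // [strand a d i.+2]strandS /= odd_i /=.
      by rewrite /west; ring: tK.
    exact: even_level.
  + by rewrite even_level // strand0 strand1 /west; ring: tK.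
  + by rewrite even_level ?odd_double.
Qed.

Lemma region_strandP a d reg : is_region_coloring (strand_coloring a d) reg ->
  reg = strand_regions a d (reg (inl top, SE)).
Proof.
move=> reg_P; have strand_P := strand_regionsP a d (reg (inl top, SE)).
apply/ffunP=> -[v c]; move: v c; apply: twist_connected => [c|[v c] eq_v c'].
  by apply: (@region_coloring_turn _ _ _ _ _ reg_P strand_P _ SE);
     rewrite ffunE.
exact: (region_coloring_glue reg_P strand_P).
Qed.

Definition strand_shadow (x : R * R * R) :=
  (strand_coloring x.1.1 x.1.2, strand_regions x.1.1 x.1.2 x.2).

Lemma strand_shadow_inj : injective strand_shadow.
Proof.
move=> [[a d] e] [[a' d'] e'] [/ffunP eq_col /ffunP eq_reg].
have:= eq_reg (inl top, SE); rewrite !ffunE /= /ends /= => ->.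
have:= eq_col (inl top, NW); rewrite !ffunE /= /ends /= !strand1 => eq_a.
have:= eq_col (inl top, NE); rewrite !ffunE /= /ends /= !strand0 eq_a.
by move=> /addrI ->.
Qed.

Lemma shadow_colorings_strand :
  shadow_colorings X D = [set strand_shadow x | x : R * R * R].
Proof.
apply/setP=> -[col reg]; rewrite inE /=; apply/andP/imsetP => [[]|].
  move=> /coloring_strandP[a [d ->]] /region_strandP ->.
  by exists (a, d, reg (inl top, SE)).
move=> [[[a d] e] _ [-> ->]]; split; first exact: strand_coloringP.
exact: strand_regionsP.
Qed.

(** * The cocycle invariant *)

Lemma sum_ord_double (V : nmodType) m (F : nat -> V) :
  \sum_(i < m.*2) F i = \sum_(k < m) (F k.*2 + F k.*2.+1).
Proof.
elim: m => [|m IHm]; first by rewrite !big_ord0.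
by rewrite doubleS !big_ord_recr /= IHm addrA.
Qed.

Section Weight.
Variables (q1 q2 : nat).
Hypotheses (D1 : additive_exp R q1) (D2 : additive_exp R q2).
Variable theta : cocycle3 X R.
Hypothesis thetaE :
  forall x y z : R, theta x y z = (x - y) ^+ q1 * (y - z) ^+ q2.

(** Two consecutive crossings of the column with a common source region have
    opposite second factors, and so do the two crossings of the clasp; by
    additivity the difference of the first factors is the [q1]-th power of
    a multiple of [d]. *)
Lemma strand_weight x : cocycle_weight theta (strand_shadow x) =
  (- (n%:R * tV ^+ q1) + K ^+ (q1 + q2)) * x.1.2 ^+ (q1 + q2).
Proof.
case: x => [[a d] e] /=; rewrite /cocycle_weight /strand_shadow.
rewrite big_sumType big_bool /=.
transitivity (- (n%:R * ((tV * d) ^+ q1 * (tV * d) ^+ q2))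
  + (tV * K * d) ^+ q1 * (K * d) ^+ q2); last first.
  by rewrite -(twist_coefficient tK tE D1 D2) !exprMn !exprD; ring.
congr (_ + _).
  (* Crossings 2k and 2k+1 have the region between them as common source. *)
  pose F j := if odd j
    then theta (level a d e j) (strand a d j) (strand a d j.+1)
    else theta (level a d e j.+1) (strand a d j.+2) (strand a d j.+1).
  transitivity (\sum_(i < n.*2) F i).
    apply: eq_bigr => i _; rewrite /source_sector !ffunE /F /=.
    by case: (odd i); rewrite /= !rotate_ends /ends /= mulr1z.
  rewrite sum_ord_double.
  have pairE k : F k.*2 + F k.*2.+1 = - ((tV * d) ^+ q1 * (tV * d) ^+ q2).
    rewrite /F /= odd_double !thetaE /level /= odd_double /=.
    set s := strand a d k.*2.+1.
    have -> : strand a d k.*2.+2 = s + tV * d by rewrite strandS /= odd_double.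
    have -> : tV * (e - (1 - t) * s) - (s + tV * d) = tV * (e - s) - tV * d.
      by ring: tK.
    have -> : tV * (e - (1 - t) * s) - s = tV * (e - s) by ring: tK.
    have -> : s + tV * d - s = tV * d by ring.
    have -> : s - (s + tV * d) = - (tV * d) by ring.
    by rewrite (additive_expB D1) (additive_expN D2); ring.
  under eq_bigr do rewrite pairE.
  by rewrite sumr_const card_ord mulNrn mulr_natl.
rewrite /source_sector /= !rotate_ends !ffunE /ends /= !thetaE !mulrN1z.
rewrite strand0 strand1 strand_last strand_lastS /west.
have -> : a - (a + K * d) = - (K * d) by ring.
have -> : a + d + K * d - (a + d) = K * d by ring.
rewrite (additive_expN D2) mulrN opprK -mulrBl -(additive_expB D1).
by congr (_ ^+ q1 * _); rewrite (tV_twist_unit tK tE); ring.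
Qed.

Lemma strand_invariant : cocycle_invariant D theta =
  (\big[msetD/mset0]_(s : R)
    msetn (#|{: R}| ^ 2)%N
      ((- (n%:R * tV ^+ q1) + K ^+ (q1 + q2)) * s ^+ (q1 + q2)))%mset.
Proof.
pose c (s : R) : R :=
  (- (n%:R * tV ^+ q1) + K ^+ (q1 + q2)) * s ^+ (q1 + q2).
apply/msetP => y; transitivity (\sum_(x : R * R * R) (c x.1.2 == y))%N.
  rewrite mset_seqE count_map -sum1_count big_enum_cond.
  rewrite shadow_colorings_strand big_imset_cond /=; last first.
    by move=> x1 x2 _ _ /strand_shadow_inj.
  rewrite big_mkcond /=; apply: eq_bigr => x _.
  by rewrite /= strand_weight -/(c _); case: eqP.
rewrite (big_morph (fun A : {mset R}%mset => A y)
           (fun A B => (msetE2 A B y).1.1.1) (mset0E y)).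
rewrite -(pair_bigA _ (fun ad e => nat_of_bool (c ad.2 == y))) /=.
rewrite -(pair_bigA _ (fun a d => \sum_(e : R) nat_of_bool (c d == y)))%N /=.
rewrite exchange_big /=; apply: eq_bigr => d _.
rewrite !sum_nat_const msetnE eq_sym -/(c d).
by case: eqP => _; rewrite ?muln0 // muln1 mulnn.
Qed.

End Weight.
End TwistColorings.

Unset Implicit Arguments.
Unset Strict Implicit.

Theorem proposition3p5 (p n m1 m2 : nat) (p_pr : prime p) (n_gt0 : (0 < n)%N) :
  let X := twist_ring p n in
  let t := twist_t p n in
  let tV := twist_tV p n in
  let a1 := (p ^ m1)%N in
  let a2 := (p ^ m2)%N in
  cocycle_invariant (twist_knot n_gt0) (twist_cocycle p_pr n m1 m2) =
    \big[msetD/mset0]_(s : X)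
      msetn (#|{: X}| ^ 2)%N
        ((- (n%:R * tV ^+ a1) + (1 + n%:R * (1 - t)) ^+ (a1 + a2))
           * s ^+ (a1 + a2)).
Proof.
apply: strand_invariant => //; try exact: twist_tE; exact: twist_Frobenius.
Qed.
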